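(* Let $(G,X,x_0)$ be a $0$-dimensional ambit and let $S\subseteq X$. The following are equivalent: (1) The $G$-ambit $X$ has $S$-DRP. (2) There exists $\eta\in E(X)$ such that $\eta[S]\subseteq \mathrm{Inv}(X)$.
   Context: Compact spaces are Hausdorff. A flow $(G,X)$ is a topological group $G$ acting continuously on a compact space $X$. An ambit $(G,X,x_0)$ is a flow with a distinguished point $x_0\in X$ whose orbit $Gx_0$ is dense in $X$; it is $0$-dimensional if $X$ is $0$-dimensional (has a basis of clopen sets). $\mathrm{Inv}(X)$ is the set of points of $X$ fixed by all $g\in G$. The Ellis semigroup $E(X)$ is the closure in $X^X$ (product topology) of the set of maps $x\mapsto gx$, $g\in G$, with composition. A coloring is a function $c\colon G\to 2^n$ for some natural number $n\ge 1$. For $S\subseteq X$, $c$ is $S$-definable if there are clopen sets $U_0,\dots,U_{n-1}\subseteq X$ and points $y_0,\dots,y_{n-1}\in S$ such that for all $g\in G$, $i<n$: $c(g)(i)=1$ if $y_i\in gU_i$ and $c(g)(i)=0$ if $y_i\notin gU_i$. The ambit has the $S$-definable Ramsey property ($S$-DRP) if for every $S$-definable coloring $c\colon G\to 2^n$, every $k\ge 1$ and every $A\in[G]^k$ (a $k$-element subset of $G$) there is $h\in G$ such that $|c[hA]|=1$. *)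

(* Defs.v *)
From HB Require Import structures.
From mathcomp Require Import all_boot.
From mathcomp Require Import finmap.
From mathcomp Require Import boolp classical_sets topology.

Set Implicit Arguments.
Unset Strict Implicit.
Unset Printing Implicit Defensive.

Local Open Scope classical_set_scope.

HB.mixin Record Group_Topological_isTopologicalGroup G
    of Group G & Topological G := {
  mulg_continuous : continuous (fun p : G * G => (p.1 * p.2)%g) ;
  invg_continuous : continuous (fun g : G => (g^-1)%g)
}.

#[short(type="topologicalGroupType")]
HB.structure Definition TopologicalGroup :=
  {G of Group G & Topological G & Group_Topological_isTopologicalGroup G}.

Section Flow.
Context {G : topologicalGroupType} {X : topologicalType}.
Implicit Types (act : G -> X -> X) (S : set X).

Record is_flow act : Prop := {
  flow_compact : compact [set: X] ;
  flow_hausdorff : hausdorff_space X ;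
  flow_act1 : forall x, act 1%g x = x ;
  flow_actM : forall g h x, act (g * h)%g x = act g (act h x) ;
  flow_continuous : continuous (fun p : G * X => act p.1 p.2)
}.

Record is_ambit act (x0 : X) : Prop := {
  ambit_flow : is_flow act ;
  ambit_dense : dense [set act g x0 | g in [set: G]]
}.

Definition Inv act : set X := [set x | forall g, act g x = x].

(* Only the carrier of the Ellis semigroup; [{ptws X -> X}] is X^X with the
   product topology. *)
Definition ellis act : set {ptws X -> X} :=
  closure [set (act g : {ptws X -> X}) | g in [set: G]].

Definition definable_coloring act S n (c : G -> {ffun 'I_n -> bool}) : Prop :=
  exists (U : 'I_n -> set X) (y : 'I_n -> X),
    [/\ forall i, clopen (U i),
        forall i, S (y i) &
        forall g i, ((act g @` U i) (y i) -> c g i = true) /\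
                    (~ (act g @` U i) (y i) -> c g i = false)].

Definition DRP act S : Prop :=
  forall n (c : G -> {ffun 'I_n -> bool}), (0 < n)%N ->
    definable_coloring act S c ->
  forall k (A : {fset G}), (0 < k)%N -> #|` A|%fset = k ->
  exists h : G, #|` [fset c (h * a)%g | a in A]|%fset = 1%N.

End Flow.

(* Not the library's [zero_dimensional], which asks instead that clopen sets
   separate points. *)
Definition clopen_basis (X : topologicalType) : Prop := basis (@clopen X).

(* Main.v *)
Require Import Defs.
From mathcomp Require Import all_boot.
From mathcomp Require Import finmap.
From mathcomp Require Import boolp classical_sets topology.

(** Since [y] lies in the translate [h a U] exactly when [U] contains
    [a^-1 (h^-1 y)], a definable coloring is constant on [h A] precisely when
    none of its clopen sets [U i] distinguishes the points [a^-1 (h^-1 (y i))],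
    for [a] in [A].  Putting the identity in [A] and writing [g = h^-1], the
    Ramsey property says that, for finitely many triples [(y, U, a)], some [g]
    makes each point [g y] look fixed by [a^-1] as far as [U] can tell
    ([DRP_finitely_fixable]).

    The points that look so to [U] form a clopen set [undetected U a], so each
    triple imposes a clopen condition on a map in X^X, through its value at [y].
    If [eta] in the Ellis semigroup sends [S] into the fixed points, it
    satisfies all these conditions, and finitely many of them define a
    neighborhood of [eta], which meets the orbit of the identity.  Conversely,
    if every finite list of conditions is satisfied by some group element, then
    compactness of X^X gives a limit [eta] of group elements satisfying all of
    them; every [eta y] with [y] in [S] is then not separated from any of its
    translates by a clopen set, hence is fixed. *)

Local Open Scope classical_set_scope.

Section Ramsey.
Context {G : topologicalGroupType} {X : topologicalType}.
Variables (act : G -> X -> X) (S : set X).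
Implicit Types (U : set X) (a g h : G) (D : seq (X * set X * G)).

Definition undetected U a : set X := [set x | U x <-> U (act a^-1%g x)].

Definition admissible D : Prop :=
  forall t, t \in D -> clopen t.1.2 /\ S t.1.1.

Definition looks_fixed D : set G :=
  [set g | forall t, t \in D -> undetected t.1.2 t.2 (act g t.1.1)].

(** The form of the Ramsey property in which colorings no longer appear. *)
Definition finitely_fixable : Prop :=
  forall D, admissible D -> looks_fixed D !=set0.

Hypothesis flow : is_flow act.

Lemma act_translateP g U y : (act g @` U) y <-> U (act g^-1%g y).
Proof.
split=> [[x Ux <-]|Ugy].
  by rewrite -(flow_actM flow) mulVg (flow_act1 flow).
by exists (act g^-1%g y); rewrite // -(flow_actM flow) mulgV (flow_act1 flow).
Qed.

Lemma definable_coloringP n (c : G -> {ffun 'I_n -> bool}) :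
  definable_coloring act S c <->
  exists (U : 'I_n -> set X) (y : 'I_n -> X),
    [/\ forall i, clopen (U i), forall i, S (y i)
      & forall g i, c g i = `[< U i (act g^-1%g (y i)) >]].
Proof.
split=> -[U [y [cU Sy cE]]]; exists U, y; split=> // g i.
  have [c1 c0] := cE g i; case: asboolP => [Ugy|nUgy].
    exact/c1/act_translateP.
  by apply: c0 => /act_translateP.
rewrite cE; split=> [/act_translateP Ugy|nUgy]; first exact/asboolP.
by apply/asboolP => Ugy; apply/nUgy/act_translateP.
Qed.

(** A finite list of triples becomes a coloring by taking one coordinate per
    triple; conversely a coloring and a finite set [A] become the list of all
    [(y i, U i, a)].  In both directions [g] is the inverse of the translating
    element [h]. *)
Lemma DRP_finitely_fixable : DRP act S <-> finitely_fixable.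
Proof.
split=> [drp D admD|fix_ n c n_gt0 /definable_coloringP[U [y [cU Sy cE]]] k A].
  have [D0|Dn0] := posnP (size D).
    by exists 1%g => t; rewrite (size0nil D0).
  pose t i := tnth (in_tuple D) i.
  have tD i : t i \in D by exact: mem_tnth.
  pose c g := [ffun i => `[< (t i).1.2 (act g^-1%g (t i).1.1) >]].
  have cdef : definable_coloring act S c.
    apply/definable_coloringP; exists (fun i => (t i).1.2), (fun i => (t i).1.1).
    by split=> [i|i|g i]; [case: (admD _ (tD i))..|rewrite ffunE].
  (* The identity serves as reference: comparing its color with that of [t.2]
     compares [U] at a point with [U] at the translated point. *)
  pose A := (1%g |` [fset u.2 | u in D])%fset.
  have A_gt0 : (0 < #|` A|)%N.
    by rewrite cardfs_gt0; apply/fset0Pn; exists 1%g; rewrite !inE eqxx.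
  have [h /eqP/cardfs1P[d dE]] := drp _ c Dn0 cdef _ A A_gt0 erefl.
  have col a : a \in A -> c (h * a)%g = d.
    by move=> aA; apply/fset1P; rewrite -dE; apply: in_imfset.
  exists h^-1%g => u uD.
  have /tnthP[i uE] : u \in in_tuple D by [].
  have uA : u.2 \in A.
    by rewrite !inE; apply/orP; right; apply: (in_imfset _ (fun u => u.2)).
  have := col _ uA; rewrite -(col 1%g) ?inE ?eqxx// => /ffunP/(_ i).
  rewrite !ffunE -[t i]uE mulg1 invgM (flow_actM flow) => e.
  by split=> /asboolP; [rewrite -e|rewrite e] => /asboolP.
move=> k_gt0 Ak.
have [|g gE] := fix_ [seq (y i, U i, a) | i <- enum 'I_n, a <- enum_fset A].
  by move=> t /allpairsP[p [_ _ ->]]; split; [exact: cU|exact: Sy].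
have [a0 a0A] : exists a, a \in A.
  by apply/fset0Pn; rewrite -cardfs_gt0 Ak.
(* The color of [g^-1 * a] is the same for all [a] in [A]: it tells which [U i]
   contain [act g (y i)]. *)
pose d := [ffun i => `[< U i (act g (y i)) >]].
have col a : a \in A -> c (g^-1 * a)%g = d.
  move=> aA; apply/ffunP => i; rewrite cE ffunE invgM invgK (flow_actM flow).
  have [|UgV VUg] := gE (y i, U i, a).
    by apply/allpairsP; exists (i, a); rewrite mem_enum.
  exact: asbool_equiv_eq.
exists g^-1%g; apply/eqP/cardfs1P; exists d; apply/fsetP => e; rewrite inE.
apply/imfsetP/eqP => [[a aA ->]|->]; first exact: col.
by exists a0; rewrite ?col.
Qed.

Lemma act_continuous g : continuous (act g).
Proof.
move=> x; apply: (@continuous_comp _ _ _ (pair g) (fun p => act p.1 p.2)).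
  by apply: cvg_pair; [exact: cvg_cst|exact: cvg_id].
exact: (flow_continuous flow).
Qed.

Lemma clopen_undetected U a : clopen U -> clopen (undetected U a).
Proof.
move=> cU; pose V := act a^-1%g @^-1` U.
have cV : clopen V by apply: preimage_clopen => //; exact: act_continuous.
have -> : undetected U a = (U `&` V) `|` (~` U `&` ~` V).
  apply/seteqP; split=> x; last by case=> -[]; rewrite /undetected /=; tauto.
  rewrite /undetected /V /setU /setI /setC /=.
  by have := pselect (U x); tauto.
by apply: clopenU; apply: clopenI => //; exact: clopenC.
Qed.

(** In a Hausdorff space with a clopen basis, clopen sets separate points. *)
Lemma undetected_fixed a (x : X) : clopen_basis X ->
  (forall U, clopen U -> undetected U a x) -> act a^-1%g x = x.
Proof.
move=> [_ basisX] xfix; apply/esym/(flow_hausdorff flow) => A B xA ayB.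
have [U [cU Ux] UA] := basisX x A xA.
have [V [cV Vax] VB] := basisX _ B ayB.
by exists x; split; [exact: UA|apply/VB/(xfix V cV)].
Qed.

Lemma ellis_finitely_fixable (eta : {ptws X -> X}) :
  ellis act eta -> eta @` S `<=` Inv act -> finitely_fixable.
Proof.
move=> eta_ellis etaS D admD.
suff : nbhs eta [set f : {ptws X -> X} | forall t, t \in D ->
    undetected t.1.2 t.2 (f t.1.1)].
  by move=> /eta_ellis[_ [[g _ <-] gD]]; exists g.
elim: D admD => [_|t D IHD admD]; first by apply: filterS filterT => f _ t.
have {}IHD := IHD (fun u uD => admD u (@mem_behead _ (t :: D) u uD)).
have [cU Sy] := admD t (mem_head t D).
have eta_t : undetected t.1.2 t.2 (eta t.1.1).
  have eta_fixed : Inv act (eta t.1.1) by apply: etaS; exists t.1.1.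
  by rewrite /undetected/= eta_fixed.
have [oU _] := clopen_undetected t.1.2 t.2 cU.
have nU : nbhs (eta t.1.1) (undetected t.1.2 t.2) by exact: open_nbhs_nbhs.
have := @proj_continuous X (fun=> X) t.1.1 eta _ nU.
apply: filterS2 IHD => f fD ft u; rewrite inE => /orP[/eqP ->//|].
exact: fD.
Qed.

(** The sets [looks_fixed D] generate a proper filter on [G]; a cluster point
    of its image in the compact space X^X meets every condition, because the
    conditions are closed. *)
Lemma finitely_fixable_ellis : clopen_basis X -> finitely_fixable ->
  exists2 eta, ellis act eta & eta @` S `<=` Inv act.
Proof.
move=> basisX fix_.
pose F := filter_from admissible looks_fixed.
have F_proper : ProperFilter F.
  apply: filter_from_proper => //; apply: filter_from_filter.
    by exists [::].
  move=> D1 D2 adm1 adm2; exists (D1 ++ D2).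
    by move=> t; rewrite mem_cat => /orP[/adm1|/adm2].
  by move=> g gD; split=> t tD; apply: gD; rewrite mem_cat tD ?orbT.
pose T : G -> {ptws X -> X} := act.
have cptXX : compact [set f : {ptws X -> X} | forall x, [set: X] (f x)].
  by apply: (@tychonoff X (fun=> X) (fun=> setT)) => _; exact: flow_compact flow.
have [eta [_ eta_cl]] := cptXX (T @ F) _ (filterS (fun _ _ _ => I) filterT).
exists eta => [B nB|_ [y Sy <-] a].
  by apply: eta_cl => //; exists [::] => // g _; exists g.
rewrite -[a]invgK; apply: undetected_fixed => // U cU.
have [_ clU] := clopen_undetected U a^-1%g cU.
apply: clU => B nB.
have FU : (T @ F) [set f | undetected U a^-1%g (f y)].
  exists [:: (y, U, a^-1%g)] => [t|g gD]; first by rewrite inE => /eqP ->.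
  by apply: (gD (y, U, a^-1%g)); rewrite inE.
have [f [fU fB]] := eta_cl _ _ FU (@proj_continuous X (fun=> X) y eta _ nB).
by exists (f y).
Qed.

End Ramsey.

Theorem proposition3p3 (G : topologicalGroupType) (X : topologicalType)
    (act : G -> X -> X) (x0 : X) (S : set X) :
  is_ambit act x0 -> clopen_basis X ->
  DRP act S <-> exists2 eta, ellis act eta & eta @` S `<=` Inv act.
Proof.
move=> [flow _] basisX; rewrite (DRP_finitely_fixable _ _ flow).
split=> [|[eta]]; first exact: finitely_fixable_ellis.
exact: ellis_finitely_fixable.
Qed.
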